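(* Let $(x_1,x_2)$ be a pair of consecutive solutions in $S$ (so $V_1(x_1)<V_1(x_2)$) such that $V_2(x_1)\ge \beta > V_2(x_2)$, and let $\delta\in\mathbb{R}^+$ be such that $\mu_\delta(x_1)=\mu_\delta(x_2)$. Then, among all Pareto-supported pairs, the pair $(x_1,\delta)$ minimizes $\overline{V}_1$; that is, $\overline{V}_1(x_1,\delta)\le \overline{V}_1(x_1',\delta')$ for every Pareto-supported pair $(x_1',\delta')$.
   Context: Problem $(P)$: maximize $cx$ subject to $x\in X$, $\beta\le\gamma x\le\alpha$ (main additional constraint), and $\widetilde\beta_k\le\widetilde\gamma^k x\le\widetilde\alpha_k$ for $k\in\{1,\dots,K\}$, where $X\subset\mathbb{R}^n$ is nonempty, $\alpha,\beta,\widetilde\alpha_k,\widetilde\beta_k\in\mathbb{R}$, and $c,\gamma,\widetilde\gamma^k\in\mathbb{R}^n$. Standing assumptions: the convex hull of $X$ is a polytope (bounded, finitely many extreme points), and there is an optimal solution $x^*_{SP}$ of $\max_{x\in X}cx$ with $\gamma x^*_{SP}\le\beta$. The bi-objective relaxation $(BOR)$ maximizes the vector $(V_1(x),V_2(x))=(cx,\gamma x)$ over $x\in X$; its solutions are the elements of $X$. For $\delta\in\mathbb{R}^+$ (nonnegative reals), $\mu_\delta(x)=V_1(x)+\delta V_2(x)$, and by convention $\mu_{+\infty}(x)=V_2(x)$. A solution $x$ strongly Pareto-dominates $x'$ if $V_1(x)\ge V_1(x')$ and $V_2(x)\ge V_2(x')$ with at least one strict inequality; $x$ is Pareto-optimal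 if no solution strongly dominates it. A solution $x$ is Pareto-supported if it is Pareto-optimal, $(V_1(x),V_2(x))$ is an extreme point of the convex hull of $\{(V_1(y),V_2(y)): y\in X\}$, and $x$ maximizes $\mu_\delta$ over $X$ for some $\delta\in\mathbb{R}^+\cup\{+\infty\}$. $S$ is the set of Pareto-supported solutions, with one representative kept for each pair of values $(V_1,V_2)$, ordered by increasing $V_1$; ''consecutive'' refers to this order. A pair $(x_1,\delta)\in S\times\mathbb{R}^+$ is a Pareto-supported pair if there exists $x_2\in S$ such that $(x_1,x_2)$ is a pair of consecutive solutions in $S$ and $\mu_\delta(x_1)=\mu_\delta(x_2)$. For such a pair, $\overline{V}_1(x_1,\delta)=\mu_\delta(x_1)-\delta\beta$. *)

(* Defs.v *)
From HB Require Import structures.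
From mathcomp Require Import all_boot all_order all_algebra.
From mathcomp Require Import all_classical all_reals all_analysis.

Set Implicit Arguments.
Unset Strict Implicit.
Unset Printing Implicit Defensive.

Import Order.TTheory GRing.Theory Num.Theory.
Local Open Scope classical_set_scope.
Local Open Scope ring_scope.

Section Convexity.
Context {R : realType} {M : lmodType R}.

Definition convex_hull (A : set M) : set M := smallest (@convex_set R M) A.

(** "Bounded with finitely many extreme points" alone would also allow sets
    that are not closed, e.g. an open ball (no extreme point at all); as usual,
    a polytope is the convex hull of a finite set of points. *)
Definition polytope (C : set M) : Prop :=
  exists2 F : set M, finite_set F & C = convex_hull F.

Definition extreme_point (C : set M) (p : M) : Prop :=
  C p /\ forall (a b : M) (t : R), C a -> C b -> 0 < t < 1 ->
    p = t *: a + (1 - t) *: b -> a = p /\ b = p.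

End Convexity.

(** The data of problem (P):
      maximize  c x  subject to  x in X,  beta <= gamma x <= alpha,
      and  betat k <= gammat k x <= alphat k  for all k : 'I_K.
    Points are columns; c, gamma and gammat k are rows. *)
Record problem (R : realType) (n K : nat) := Problem {
  X : set 'cV[R]_n;
  c : 'rV[R]_n;
  gamma : 'rV[R]_n;
  alpha : R;
  beta : R;
  gammat : 'I_K -> 'rV[R]_n;
  alphat : 'I_K -> R;
  betat : 'I_K -> R
}.

Section BiObjectiveRelaxation.
Context {R : realType} {n K : nat}.
Variable P : problem R n K.

Definition V1 (x : 'cV[R]_n) : R := (c P *m x) 0 0.
Definition V2 (x : 'cV[R]_n) : R := (gamma P *m x) 0 0.

(** [R^o] is [R] seen as a module over itself, so that the plane of values
    is a module over [R]. *)
Definition V (x : 'cV[R]_n) : R^o * R^o := (V1 x, V2 x).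

(** Only used for [0 <= delta]; the value at [-oo] is irrelevant. *)
Definition mu (delta : \bar R) (x : 'cV[R]_n) : R :=
  if delta is d%:E then V1 x + d * V2 x else V2 x.

Definition SP_optimal (x : 'cV[R]_n) : Prop :=
  X P x /\ forall y, X P y -> V1 y <= V1 x.

Definition strongly_dominates (x x' : 'cV[R]_n) : Prop :=
  [/\ V1 x >= V1 x', V2 x >= V2 x' & V1 x > V1 x' \/ V2 x > V2 x'].

Definition pareto_optimal (x : 'cV[R]_n) : Prop :=
  X P x /\ ~ exists2 y, X P y & strongly_dominates y x.

Definition pareto_supported (x : 'cV[R]_n) : Prop :=
  [/\ pareto_optimal x,
      extreme_point (convex_hull (V @` X P)) (V x) &
      exists2 delta : \bar R, (0 <= delta)%E &
        forall y, X P y -> mu delta y <= mu delta x].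

Definition supported_representatives (S : set 'cV[R]_n) : Prop :=
  [/\ S `<=` pareto_supported,
      V @` S = V @` pareto_supported &
      set_inj S V].

Definition consecutive (S : set 'cV[R]_n) (x1 x2 : 'cV[R]_n) : Prop :=
  [/\ S x1, S x2, V1 x1 < V1 x2 &
      ~ exists2 x3, S x3 & V1 x1 < V1 x3 < V1 x2].

Definition pareto_supported_pair (S : set 'cV[R]_n)
    (x1 : 'cV[R]_n) (delta : R) : Prop :=
  [/\ S x1, 0 <= delta &
      exists2 x2, consecutive S x1 x2 & mu delta%:E x1 = mu delta%:E x2].

Definition V1bar (x1 : 'cV[R]_n) (delta : R) : R :=
  mu delta%:E x1 - delta * beta P.

End BiObjectiveRelaxation.

(* Main.v *)
Require Import Defs.
From mathcomp Require Import all_boot all_order all_algebra.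
From mathcomp Require Import all_classical all_reals all_analysis.
From mathcomp Require Import ring lra.
Import Order.TTheory GRing.Theory Num.Theory.
Local Open Scope classical_set_scope.
Local Open Scope ring_scope.

(** Geometrically, [V1bar x1' delta'] is the first coordinate of the point at
    height [V2 = beta] on the line through the values of [x1'] and its
    successor in [S].  The values of [S] lie on a concave chain, so the line
    through two consecutive values has all the others on or below it:
    [x1'] maximizes [mu delta'] over [S] (lemma [pair_maximizes_mu]).

    Now [V2 x1 >= beta > V2 x2], so height [beta] is met by the segment from
    [V x1] to [V x2], in a point of first coordinate [V1bar x1 delta].  Both
    ends of the segment are on or below the line of the pair [(x1', delta')],
    hence so is this point, which is the claim.

    Concavity of the chain comes from supportedness: a solution that
    maximizes some weighted objective cannot lie below a chord joining two
    solutions on either side of it (lemma [supported_above_chord]). *)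

Section SupportedChain.
Context {R : realType} {n K : nat} {P : problem R n K}.
Implicit Types (p q r x y : 'cV[R]_n) (S : set 'cV[R]_n).

(** The weight [d] for which [q] is optimal cannot be [0], as [V1 q < V1 r].
    With [d] positive or infinite, [V2 q] is at least the [V2] of the point of
    the chord [p r] that has the same [V1] as [q]; as [e >= 0], the same
    comparison then holds for [mu e].
    The weights of [p] and [r] are left unnormalized to avoid a division. *)
Lemma supported_above_chord {p q r} {e : R} :
  pareto_supported P q -> X P p -> X P r -> V1 P p < V1 P q < V1 P r ->
  0 <= e ->
  (V1 P r - V1 P q) * mu P e%:E p + (V1 P q - V1 P p) * mu P e%:E r
    <= (V1 P r - V1 P p) * mu P e%:E q.
Proof.
move=> [_ _ [d d_ge0 q_max]] Xp Xr /andP[pq qr] e_ge0.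
move: (q_max p Xp) (q_max r Xr) => {q_max}.
suff chord : mu P d p <= mu P d q -> mu P d r <= mu P d q ->
    (V1 P r - V1 P q) * V2 P p + (V1 P q - V1 P p) * V2 P r
      <= (V1 P r - V1 P p) * V2 P q.
  move=> /chord /[apply] /(ler_wpM2l e_ge0); rewrite /mu; lra.
case: d d_ge0 => [d| |] //=; rewrite /mu; last first.
  by move=> _ hp hr; nra.
rewrite lee_fin le_eqVlt => /orP[/eqP <-|d_gt0] hp hr; first by lra.
rewrite -(ler_pM2l d_gt0).
have rq_ge0 : 0 <= V1 P r - V1 P q by lra.
have qp_ge0 : 0 <= V1 P q - V1 P p by lra.
have := ler_wpM2l rq_ge0 hp; have := ler_wpM2l qp_ge0 hr; lra.
Qed.

Lemma pareto_eq_V2 {x y} :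
  pareto_optimal P x -> pareto_optimal P y -> V1 P x = V1 P y ->
  V2 P x = V2 P y.
Proof.
move=> [Xx x_opt] [Xy y_opt] xy1.
case: (ltgtP (V2 P x) (V2 P y)) => // xy2; exfalso.
  by apply: x_opt; exists y => //; split; [rewrite xy1|exact: ltW|right].
by apply: y_opt; exists x => //; split; [rewrite xy1|exact: ltW|right].
Qed.

(** Any other [y] of [S] is on the far side of [x] or of its successor, say
    of [x].  Then [mu e x] is at least a weighted mean of [mu e y] and the
    value of [mu e] at the successor; as the latter equals [mu e x], [mu e y]
    cannot be larger. *)
Lemma pair_maximizes_mu {S x y} {e : R} :
  S `<=` pareto_supported P -> pareto_supported_pair P S x e -> S y ->
  mu P e%:E y <= mu P e%:E x.
Proof.
move=> S_supp [Sx e_ge0 [x' [_ Sx' xx' no_between] mu_xx']] Sy.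
have X_S z : S z -> X P z by move=> /S_supp[[]].
have mu_eq_V1 z : S z -> V1 P y = V1 P z -> mu P e%:E y = mu P e%:E z.
  move=> Sz yz; have [y_opt _ _] := S_supp _ Sy.
  have [z_opt _ _] := S_supp _ Sz.
  by rewrite /mu (pareto_eq_V2 y_opt z_opt yz) yz.
case: (ltgtP (V1 P y) (V1 P x)) => [yx|xy|/(mu_eq_V1 _ Sx) -> //].
  have := supported_above_chord (S_supp _ Sx) (X_S _ Sy) (X_S _ Sx')
    _ e_ge0; rewrite yx xx' => /(_ isT).
  rewrite -mu_xx' => chord.
  have xx'_gt0 : 0 < V1 P x' - V1 P x by lra.
  by rewrite -(ler_pM2l xx'_gt0); lra.
case: (ltgtP (V1 P y) (V1 P x')) => [yx'|x'y|/(mu_eq_V1 _ Sx') ->].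
- by case: no_between; exists y => //; rewrite xy yx'.
- have := supported_above_chord (S_supp _ Sx') (X_S _ Sx) (X_S _ Sy)
    _ e_ge0; rewrite x'y xx' => /(_ isT).
  rewrite -mu_xx' => chord.
  have xx'_gt0 : 0 < V1 P x' - V1 P x by lra.
  by rewrite -(ler_pM2l xx'_gt0); lra.
- by rewrite mu_xx'.
Qed.

End SupportedChain.

Theorem theorem1 (R : realType) (n K : nat) (P : problem R n K)
  (X_nonempty : X P !=set0)
  (X_polytope : polytope (convex_hull (X P)))
  (SP_beta : exists2 xSP : 'cV[R]_n, SP_optimal P xSP & (gamma P *m xSP) 0 0 <= beta P)
  (S : set 'cV[R]_n) (S_repr : supported_representatives P S)
  (x1 x2 : 'cV[R]_n) (delta : R)
  (x12 : consecutive P S x1 x2)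
  (x1_beta : V2 P x1 >= beta P) (x2_beta : beta P > V2 P x2)
  (delta_ge0 : 0 <= delta)
  (mu_eq : mu P delta%:E x1 = mu P delta%:E x2) :
  forall (x1' : 'cV[R]_n) (delta' : R),
    pareto_supported_pair P S x1' delta' ->
    V1bar P x1 delta <= V1bar P x1' delta'.
Proof.
move=> y e pair_y; have [S_supp _ _] := S_repr; have [Sx1 Sx2 _ _] := x12.
have x1_below := pair_maximizes_mu S_supp pair_y Sx1.
have x2_below := pair_maximizes_mu S_supp pair_y Sx2.
rewrite /V1bar; set m := mu P e%:E y in x1_below x2_below *.
rewrite /mu in mu_eq x1_below x2_below *.
(* [u : w] are the barycentric weights of [x1] and [x2] at height [beta]. *)
set u := beta P - V2 P x2; set w := V2 P x1 - beta P.
have u_gt0 : 0 < u by rewrite /u; lra.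
have w_ge0 : 0 <= w by rewrite /w; lra.
have uw_gt0 : 0 < u + w by lra.
have below : u * V1 P x1 + w * V1 P x2 <= (u + w) * (m - e * beta P).
  have := ler_wpM2l (ltW u_gt0) x1_below; have := ler_wpM2l w_ge0 x2_below.
  by rewrite /u /w; lra.
have on_segment : (u + w) * (V1 P x1 + delta * V2 P x1 - delta * beta P)
    = u * V1 P x1 + w * V1 P x2.
  have -> : V1 P x2 = V1 P x1 + delta * V2 P x1 - delta * V2 P x2 by lra.
  by rewrite /u /w; ring.
by rewrite -on_segment (ler_pM2l uw_gt0) in below.
Qed.
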